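(* Let $(A,\circ)$ be a Novikov algebra and $r\in A\otimes A$. Let $\hat r=\alpha+\beta$ with $\alpha=(\hat r-\hat r^t)/2$ and $\beta=(\hat r+\hat r^t)/2$. If $\check\beta=(r+\tau r)/2$ is invariant, then the following statements are equivalent. (a) $r$ is a solution of the Novikov Yang-Baxter equation $r_{13}\circ r_{23}+r_{12}\star r_{23}+r_{13}\circ r_{12}=0$ in $A$. (b) $\hat r$ (resp. $-\hat r^t$) is an $\mathcal O$-operator of weight $1$ on $(A,\circ)$ associated to the $A$-bimodule Novikov algebra $(A^*,\circ_+,L_{A,\star}^*,-R_A^* )$ (resp. $(A^*,\circ_-,L_{A,\star}^*,-R_A^* )$), where $a^*\circ_\pm b^*=\mp2L_{A,\star}^*(\beta(a^* ))b^*$ for $a^*,b^*\in A^*$. (c) $\alpha$ is an extended $\mathcal O$-operator of weight $0$ with extension $\beta$ of mass $(-1,0)$ on $(A,\circ)$ associated to $(A^*,L_{A,\star}^*,-R_A^* )$. (d) For all $a^*,b^*\in A^*$, $(\alpha\pm\beta)(a^*\ast b^* )=(\alpha\pm\beta)(a^* )\circ(\alpha\pm\beta)(b^* )$, where $a^*\ast b^*=L_{A,\star}^*(\hat r(a^* ))b^*-(-R_A)^*(\hat r^t(b^* ))a^*$.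
   Context: $\mathbf k$ is a field of characteristic zero; all vector spaces are finite-dimensional over $\mathbf k$. A Novikov algebra $(A,\circ)$ is a vector space with a bilinear operation satisfying $(a\circ b)\circ c-a\circ(b\circ c)=(b\circ a)\circ c-b\circ(a\circ c)$ and $(a\circ b)\circ c=(a\circ c)\circ b$ for all $a,b,c\in A$. Put $a\star b=a\circ b+b\circ a$, $L_A(a)b=a\circ b$, $R_A(a)b=b\circ a$, $L_{A,\star}=L_A+R_A$. For linear $\varphi:A\to\mathrm{End}_{\mathbf k}(V)$, define $\varphi^*:A\to\mathrm{End}_{\mathbf k}(V^* )$ by $\langle\varphi^*(a)f,v\rangle=-\langle f,\varphi(a)v\rangle$. A bimodule of $(A,\circ)$ is a triple $(V,l_A,r_A)$, $l_A,r_A:A\to\mathrm{End}_{\mathbf k}(V)$ linear, with $l_A(a\circ b-b\circ a)v=l_A(a)l_A(b)v-l_A(b)l_A(a)v$; $l_A(a)r_A(b)v-r_A(b)l_A(a)v=r_A(a\circ b)v-r_A(b)r_A(a)v$; $l_A(a\circ b)v=r_A(b)l_A(a)v$; $r_A(a)r_A(b)v=r_A(b)r_A(a)v$. An $A$-bimodule Novikov algebra $(M,\cdot,l_A,r_A)$ is a Novikov algebra $(M,\cdot)$ with a bimodule structure $(M,l_A,r_A)$ of $(A,\circ)$ such that $(l_A(a)v)\cdot w-l_A(a)(v\cdot w)=(r_A(a)v)\cdot w-v\cdot(l_A(a)w)$; $r_A(a)(v\cdot w)-v\cdot(r_A(a)w)=r_A(a)(w\cdot v)-w\cdot(r_A(a)v)$;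 $(l_A(a)v)\cdot w=(l_A(a)w)\cdot v$; $r_A(a)(v\cdot w)=(r_A(a)v)\cdot w$. The triple $(A^*,L_{A,\star}^*,-R_A^* )$ is a bimodule of $(A,\circ)$, regarded with the zero product when no product is indicated; under the hypothesis of the claim, $(A^*,\circ_\pm,L_{A,\star}^*,-R_A^* )$ are $A$-bimodule Novikov algebras. Tensor notation: for $r=\sum_i x_i\otimes y_i$ in $A\otimes A$: $r_{13}\circ r_{23}=\sum_{i,j}x_i\otimes x_j\otimes y_i\circ y_j$, $r_{12}\star r_{23}=\sum_{i,j}x_i\otimes y_i\star x_j\otimes y_j$, $r_{13}\circ r_{12}=\sum_{i,j}x_i\circ x_j\otimes y_j\otimes y_i$. $\tau(a\otimes b)=b\otimes a$. For $r\in A\otimes A$, $\hat r,\hat r^t:A^*\to A$ are defined by $\langle\hat r(a^* ),b^*\rangle=\langle a^*\otimes b^*,r\rangle$ and $\langle a^*,\hat r^t(b^* )\rangle=\langle a^*\otimes b^*,r\rangle$. A symmetric $s\in A\otimes A$ is invariant if $(L_A(x)\otimes\mathrm{id}+\mathrm{id}\otimes L_{A,\star}(x))s=0$ for all $x\in A$. An $\mathcal O$-operator of weight $\lambda$ on $(A,\circ)$ associated to $(M,\cdot,l_A,r_A)$ is a linear map $\alpha:M\to A$ with $\alpha(u)\circ\alpha(v)=\alpha(l_A(\alpha(u))v+r_A(\alpha(v))u+\lambda\,u\cdot v)$. For a bimodule $(V,l_A,r_A)$ (zero product), $\alpha:V\to A$ is an extended $\mathcal O$-operator of weight $0$ with extension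 $\beta:V\to A$ of mass $(\kappa,0)$ if $\beta$ is balanced ($l_A(\beta(u))v=r_A(\beta(v))u$), $A$-invariant of mass $\kappa$ ($\kappa(x\circ\beta(u))=\kappa\beta(l_A(x)u)$ and $\kappa(\beta(u)\circ x)=\kappa\beta(r_A(x)u)$), and $\alpha(u)\circ\alpha(v)-\alpha(l_A(\alpha(u))v+r_A(\alpha(v))u)=\kappa\,\beta(u)\circ\beta(v)$. Condition (b) comprises two conditions (one for $\hat r$ with $\circ_+$, one for $-\hat r^t$ with $\circ_-$), each of which is asserted to be equivalent to the others. *)

(* Defs.v *)
From HB Require Import structures.
From mathcomp Require Import all_boot all_order all_algebra.
From mathcomp Require Import ring.

Set Implicit Arguments.
Unset Strict Implicit.
Unset Printing Implicit Defensive.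

Import GRing.Theory.
Local Open Scope ring_scope.

Declare Scope tensor_scope.
Delimit Scope tensor_scope with T.

Reserved Notation "u ⊗ v" (at level 40, left associativity).
Reserved Notation "a ∘ b" (at level 40, left associativity).

Notation dual V := 'Hom(V, _^o).

(* A bilinear map U x V -> W is an element of 'Hom(U, 'Hom(V, W)). *)

Section LinearMaps.
Variable k : fieldType.

Lemma zmod_move (V : zmodType) (x y z w : V) :
  x - y = z - w -> y = x - z + w.
Proof. by move=> e; rewrite -[LHS](subKr x) e opprB addrA addrAC. Qed.

Lemma linfunP (U V : vectType k) (f : U -> V) : linear f -> linfun f =1 f.
Proof.
move=> lf; pose g : {linear U -> V} := HB.pack f (GRing.isLinear.Build _ _ _ _ f lf).
exact: (lfunE g).
Qed.

Variables U V W : vectType k.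

Definition flip (m : 'Hom(U, 'Hom(V, W))) : 'Hom(V, 'Hom(U, W)) :=
  linfun (fun v : V => linfun (fun u : U => m u v)).

Lemma flipE m v u : flip m v u = m u v.
Proof.
have lin v' : linear (fun u : U => m u v').
  by move=> c x y; rewrite linearP lfunE /= lfunE.
rewrite linfunP ?linfunP // => c x y; apply/lfunP=> u'.
by rewrite lfunE /= lfunE /= !linfunP // linearP.
Qed.

Definition dualrep (phi : 'Hom(U, 'End(V))) : 'Hom(U, 'End(dual V)) :=
  linfun (fun a : U => linfun (fun f : dual V => - (f \o phi a)%VF)).

Lemma dualrepE phi a f v : dualrep phi a f v = - f (phi a v).
Proof.
have lin a' : linear (fun f : dual V => - (f \o phi a')%VF).
  move=> c x y; apply/lfunP=> u.
  by rewrite !(opp_lfunE, add_lfunE, scale_lfunE, comp_lfunE) opprD scalerN.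
rewrite linfunP; first by rewrite linfunP // opp_lfunE comp_lfunE.
move=> c x y; apply/lfunP=> g; rewrite add_lfunE scale_lfunE !linfunP //.
apply/lfunP => u; rewrite !(opp_lfunE, add_lfunE, scale_lfunE, comp_lfunE).
by rewrite !linearP !(add_lfunE, scale_lfunE) linearP opprD scalerN.
Qed.

End LinearMaps.

(* U ⊗ V is modelled by the matrices of coordinates in the chosen bases of U  *)
(* and V; [tlift f] is the linear map out of U ⊗ V induced by a bilinear f,   *)
(* see [tlift_sum] (it is meaningless when f is not bilinear).                *)

Section Tensor.
Variable k : fieldType.

Definition tensor (U V : vectType k) : vectType k :=
  'M[k]_(\dim {:U}, \dim {:V}).

Definition tens (U V : vectType k) (u : U) (v : V) : tensor U V :=
  \matrix_(i, j) (coord (vbasis {:U}) i u * coord (vbasis {:V}) j v).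

Local Notation "u ⊗ v" := (tens u v).

Definition bilin (U V W : lmodType k) (f : U -> V -> W) : Prop :=
  (forall u, linear (f u)) /\ (forall v, linear (f^~ v)).

Definition tlift (U V : vectType k) (W : lmodType k) (f : U -> V -> W)
    (t : tensor U V) : W :=
  \sum_i \sum_j (t : 'M_(_, _)) i j *: f (vbasis {:U})`_i (vbasis {:V})`_j.

Lemma tens_bilin (U V : vectType k) : bilin (@tens U V).
Proof.
split=> [u|v] c x y; apply/matrixP=> i j; rewrite !mxE linearP.
  by rewrite mulrDr mulrCA.
by rewrite mulrDl mulrA.
Qed.

Lemma tlift_linear (U V : vectType k) (W : lmodType k) (f : U -> V -> W) :
  linear (tlift f).
Proof.
move=> c x y; rewrite /tlift scaler_sumr -big_split; apply: eq_bigr => i _ /=.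
rewrite scaler_sumr -big_split; apply: eq_bigr => j _ /=.
by rewrite !mxE scalerDl scalerA.
Qed.

Lemma linear_sumP (U V : lmodType k) (f : U -> V) : linear f ->
  forall (I : Type) (s : seq I) (F : I -> U),
  f (\sum_(i <- s) F i) = \sum_(i <- s) f (F i).
Proof.
move=> lf; pose g : {linear U -> V} := HB.pack f (GRing.isLinear.Build _ _ _ _ f lf).
by move=> I s F; exact: (linear_sum g).
Qed.

Lemma linear_scaleP (U V : lmodType k) (f : U -> V) : linear f ->
  forall c u, f (c *: u) = c *: f u.
Proof.
move=> lf; pose g : {linear U -> V} := HB.pack f (GRing.isLinear.Build _ _ _ _ f lf).
by move=> c u; exact: (linearZ_LR g).
Qed.

Lemma tlift_tens (U V : vectType k) (W : lmodType k) (f : U -> V -> W) u v :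
  bilin f -> tlift f (u ⊗ v) = f u v.
Proof.
move=> [fr fl]; rewrite {2}(coord_vbasis (memvf u)) {2}(coord_vbasis (memvf v)).
rewrite (linear_sumP (fl _)); apply: eq_bigr => i _.
rewrite (linear_scaleP (fl _)) (linear_sumP (fr _)) scaler_sumr.
by apply: eq_bigr => j _; rewrite mxE (linear_scaleP (fr _)) scalerA.
Qed.

Lemma tlift_sum (U V : vectType k) (W : lmodType k) (f : U -> V -> W)
    (I : Type) (s : seq I) (x : I -> U) (y : I -> V) : bilin f ->
  tlift f (\sum_(i <- s) x i ⊗ y i) = \sum_(i <- s) f (x i) (y i).
Proof.
move=> bf; rewrite (linear_sumP (tlift_linear f)).
by apply: eq_bigr => i _; apply: tlift_tens.
Qed.

Lemma tensor_decomp (U V : vectType k) (t : tensor U V) :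
  exists s : seq (U * V), t = \sum_(p <- s) p.1 ⊗ p.2.
Proof.
exists [seq ((t : 'M_(_, _)) p.1 p.2 *: (vbasis {:U})`_p.1, (vbasis {:V})`_p.2)
         | p <- enum [set: 'I_(\dim {:U}) * 'I_(\dim {:V})]].
rewrite big_map big_enum /=; apply/matrixP=> i j.
have fU := basis_free (vbasisP {:U}); have fV := basis_free (vbasisP {:V}).
rewrite summxE (bigD1 (i, j)) ?inE //= !mxE linearZ /= !coord_free //.
rewrite !eqxx !mulr1 big1 ?addr0 // => -[i' j'] /= /andP[_ neq].
rewrite !mxE linearZ /= !coord_free // mulrAC.
by move: neq; rewrite xpair_eqE; do 2![case: eqVneq => //= _]; rewrite !(mulr0, mul0r).
Qed.

Definition tmap (U V U' V' : vectType k) (f : 'Hom(U, U')) (g : 'Hom(V, V'))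
    : tensor U V -> tensor U' V' :=
  tlift (fun u v => f u ⊗ g v).

Definition tswap (U V : vectType k) : tensor U V -> tensor V U :=
  tlift (fun u v => v ⊗ u).

(* The pairing <a ⊗ b, t>. *)
Definition tpair (U V : vectType k) (a : dual U) (b : dual V) (t : tensor U V)
    : k^o := tlift (fun u v => a u * b v) t.

Lemma tmap_bilin (U V U' V' : vectType k) (f : 'Hom(U, U')) (g : 'Hom(V, V')) :
  bilin (fun u v => f u ⊗ g v).
Proof.
have [br bl] := tens_bilin U' V'.
by split=> [u|v] c x y; rewrite linearP ?br ?bl.
Qed.

Lemma tswap_bilin (U V : vectType k) : bilin (fun (u : U) (v : V) => v ⊗ u).
Proof. by have [br bl] := tens_bilin V U; split=> [u|v] c x y; rewrite ?br ?bl. Qed.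

Lemma tpair_bilin (U V : vectType k) (a : dual U) (b : dual V) :
  bilin (fun u v => a u * b v).
Proof.
split=> [u|v] c x y; rewrite linearP.
  by rewrite mulrDr scalerAr.
by rewrite mulrDl scalerAl.
Qed.

(* The maps determined by                                                     *)
(*   b (hat r a) = tpair a b r   and   a (hatt r b) = tpair a b r,            *)
(* see [hatP] and [hattP].                                                    *)
Definition hat (U V : vectType k) (r : tensor U V) : 'Hom(dual U, V) :=
  linfun (fun a : dual U => tlift (fun x y => (a x : k) *: y) r).

Definition hatt (U V : vectType k) (r : tensor U V) : 'Hom(dual V, U) :=
  linfun (fun b : dual V => tlift (fun x y => (b y : k) *: x) r).

Lemma hatE (U V : vectType k) (s : seq (U * V)) (a : dual U) :
  hat (\sum_(p <- s) p.1 ⊗ p.2) a = \sum_(p <- s) (a p.1 : k) *: p.2.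
Proof.
have bil (a' : dual U) : bilin (fun x (y : V) => (a' x : k) *: y).
  split=> [u|v] c x y; first by rewrite scalerDr !scalerA mulrC.
  by rewrite linearP scalerDl scalerA.
rewrite linfunP ?tlift_sum // => c x y; rewrite !tlift_sum //.
rewrite scaler_sumr -big_split; apply: eq_bigr => i _ /=.
by rewrite !lfunE /= lfunE scalerDl scalerA.
Qed.

Lemma hattE (U V : vectType k) (s : seq (U * V)) (b : dual V) :
  hatt (\sum_(p <- s) p.1 ⊗ p.2) b = \sum_(p <- s) (b p.2 : k) *: p.1.
Proof.
have bil (b' : dual V) : bilin (fun (x : U) y => (b' y : k) *: x).
  split=> [u|v] c x y; last by rewrite scalerDr !scalerA mulrC.
  by rewrite linearP scalerDl scalerA.
rewrite linfunP ?tlift_sum // => c x y; rewrite !tlift_sum //.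
rewrite scaler_sumr -big_split; apply: eq_bigr => i _ /=.
by rewrite !lfunE /= lfunE scalerDl scalerA.
Qed.

Lemma hatP (U V : vectType k) (r : tensor U V) (a : dual U) (b : dual V) :
  b (hat r a) = tpair a b r.
Proof.
have [s ->] := tensor_decomp r; rewrite hatE /tpair tlift_sum; last exact: tpair_bilin.
by rewrite linear_sum; apply: eq_bigr => i _; rewrite linearZ.
Qed.

Lemma hattP (U V : vectType k) (r : tensor U V) (a : dual U) (b : dual V) :
  a (hatt r b) = tpair a b r.
Proof.
have [s ->] := tensor_decomp r; rewrite hattE /tpair tlift_sum; last exact: tpair_bilin.
by rewrite linear_sum; apply: eq_bigr => i _; rewrite linearZ /= mulrC.
Qed.

Lemma tmapE (U V U' V' : vectType k) (f : 'Hom(U, U')) (g : 'Hom(V, V'))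
    (s : seq (U * V)) :
  tmap f g (\sum_(p <- s) p.1 ⊗ p.2) = \sum_(p <- s) f p.1 ⊗ g p.2.
Proof. exact: (tlift_sum _ _ _ (tmap_bilin f g)). Qed.

Lemma tswapE (U V : vectType k) (s : seq (U * V)) :
  tswap (\sum_(p <- s) p.1 ⊗ p.2) = \sum_(p <- s) p.2 ⊗ p.1.
Proof. exact: (tlift_sum _ _ _ (tswap_bilin U V)). Qed.

Lemma tpairE (U V : vectType k) (a : dual U) (b : dual V) (s : seq (U * V)) :
  tpair a b (\sum_(p <- s) p.1 ⊗ p.2) = \sum_(p <- s) a p.1 * b p.2.
Proof. exact: (tlift_sum _ _ _ (tpair_bilin a b)). Qed.

Lemma tlift2_sum (U V : vectType k) (W : lmodType k)
    (f : U -> V -> U -> V -> W) (s : seq (U * V)) :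
  (forall x y, bilin (f x y)) -> (forall x y, bilin (fun x' y' => f x' y' x y)) ->
  let r := \sum_(p <- s) p.1 ⊗ p.2 in
  tlift (fun x y => tlift (f x y) r) r
  = \sum_(p <- s) \sum_(q <- s) f p.1 p.2 q.1 q.2.
Proof.
move=> bf bf' r; rewrite tlift_sum; last first.
  split=> [u|v] c x y; rewrite !tlift_sum // scaler_sumr -big_split;
    apply: eq_bigr => q _; have [fr fl] := bf' q.1 q.2; [exact: fr | exact: fl].
by apply: eq_bigr => p _; rewrite tlift_sum.
Qed.

Lemma tpair_map (U V U' V' : vectType k) (f : 'Hom(U, U')) (g : 'Hom(V, V'))
    (a : dual U') (b : dual V') t :
  tpair a b (tmap f g t) = tpair (a \o f)%VF (b \o g)%VF t.
Proof.
have [s ->] := tensor_decomp t; rewrite tmapE tpairE.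
have -> : \sum_(p <- s) f p.1 ⊗ g p.2
    = \sum_(q <- [seq (f p.1, g p.2) | p <- s]) q.1 ⊗ q.2 by rewrite big_map.
by rewrite tpairE big_map; apply: eq_bigr => p _; rewrite !comp_lfunE.
Qed.

Lemma tpair_swap (U V : vectType k) (a : dual U) (b : dual V) t :
  tpair b a (tswap t) = tpair a b t.
Proof.
have [s ->] := tensor_decomp t; rewrite tswapE tpairE.
have -> : \sum_(p <- s) p.2 ⊗ p.1
    = \sum_(q <- [seq (p.2, p.1) | p <- s]) q.1 ⊗ q.2 by rewrite big_map.
by rewrite tpairE big_map; apply: eq_bigr => p _; rewrite mulrC.
Qed.

Lemma dual_inj (V : vectType k) (x y : V) :
  (forall f : dual V, f x = f y) -> x = y.
Proof.
move=> e; rewrite (coord_vbasis (memvf x)) (coord_vbasis (memvf y)).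
apply: eq_bigr => i _; congr (_ *: _).
pose c : {linear V -> k^o} := coord (vbasis {:V}) i.
by have := e (linfun c); rewrite !lfunE.
Qed.

End Tensor.

Notation "u ⊗ v" := (tens u v) : tensor_scope.
Local Open Scope tensor_scope.

Section Novikov.
Variable k : fieldType.

Definition is_novikov (A : vectType k) (m : 'Hom(A, 'End(A))) : Prop :=
  (forall a b c, m (m a b) c - m a (m b c) = m (m b a) c - m b (m a c)) /\
  (forall a b c, m (m a b) c = m (m a c) b).

Record novikovAlg := NovikovAlg {
  nov_sort :> vectType k;
  nov_mul : 'Hom(nov_sort, 'End(nov_sort));
  nov_axiom : is_novikov nov_mul
}.

End Novikov.

Notation "a ∘ b" := (nov_mul _ a b) : tensor_scope.

Section Bimodules.
Variables (k : fieldType) (A : novikovAlg k).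

Definition Lmul : 'Hom(A, 'End(A)) := nov_mul A.
Definition Rmul : 'Hom(A, 'End(A)) := flip (nov_mul A).
Definition Lstar : 'Hom(A, 'End(A)) := Lmul + Rmul.
Definition star (a b : A) : A := a ∘ b + b ∘ a.

Lemma RmulE (a b : A) : Rmul a b = b ∘ a.
Proof. exact: flipE. Qed.

Lemma LstarE (a b : A) : Lstar a b = star a b.
Proof. by rewrite lfunE /= lfunE /= RmulE. Qed.

Definition is_bimodule (V : vectType k) (l r : 'Hom(A, 'End(V))) : Prop :=
  [/\ forall (a b : A) v, l (a ∘ b - b ∘ a) v = l a (l b v) - l b (l a v),
      forall (a b : A) v,
        l a (r b v) - r b (l a v) = r (a ∘ b) v - r b (r a v),
      forall (a b : A) v, l (a ∘ b) v = r b (l a v)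
    & forall (a b : A) v, r a (r b v) = r b (r a v)].

Record bimodule := Bimodule {
  bim_sort :> vectType k;
  bim_l : 'Hom(A, 'End(bim_sort));
  bim_r : 'Hom(A, 'End(bim_sort));
  bim_axiom : is_bimodule bim_l bim_r
}.

Definition is_bimod_novikov (M : bimodule) (m : 'Hom(M, 'End(M))) : Prop :=
  is_novikov m /\
  [/\ forall (a : A) (v w : M),
        m (bim_l M a v) w - bim_l M a (m v w)
        = m (bim_r M a v) w - m v (bim_l M a w),
      forall (a : A) (v w : M),
        bim_r M a (m v w) - m v (bim_r M a w)
        = bim_r M a (m w v) - m w (bim_r M a v),
      forall (a : A) (v w : M), m (bim_l M a v) w = m (bim_l M a w) v
    & forall (a : A) (v w : M), bim_r M a (m v w) = m (bim_r M a v) w].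

Record bimodNovikov := BimodNovikov {
  bn_bim :> bimodule;
  bn_mul : 'Hom(bn_bim, 'End(bn_bim));
  bn_axiom : is_bimod_novikov bn_mul
}.

Definition O_operator (M : bimodNovikov) (lambda : k) (alpha : 'Hom(M, A)) :
    Prop :=
  forall u v : M, alpha u ∘ alpha v
    = alpha (bim_l M (alpha u) v + bim_r M (alpha v) u + lambda *: bn_mul M u v).

Definition balanced (V : bimodule) (beta : 'Hom(V, A)) : Prop :=
  forall u v : V, bim_l V (beta u) v = bim_r V (beta v) u.

Definition inv_of_mass (V : bimodule) (kappa : k) (beta : 'Hom(V, A)) : Prop :=
  forall (x : A) (u : V),
    kappa *: (x ∘ beta u) = kappa *: beta (bim_l V x u) /\
    kappa *: (beta u ∘ x) = kappa *: beta (bim_r V x u).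

(* Weight 0, extension beta of mass (kappa, 0). *)
Definition extended_O_operator (V : bimodule) (kappa : k)
    (alpha beta : 'Hom(V, A)) : Prop :=
  [/\ balanced beta, inv_of_mass kappa beta
    & forall u v : V,
        alpha u ∘ alpha v - alpha (bim_l V (alpha u) v + bim_r V (alpha v) u)
        = kappa *: (beta u ∘ beta v)].

Lemma bimod_novikov_of_balanced (V : bimodule) (beta : 'Hom(V, A)) (c : k) :
  balanced beta -> inv_of_mass 1 beta ->
  is_bimod_novikov (c *: (bim_l V \o beta)%VF).
Proof.
move=> bal inv.
have mE u v : (c *: (bim_l V \o beta)%VF) u v = c *: bim_l V (beta u) v.
  by rewrite lfunE /= lfunE /= lfunE.
have bl x u : beta (bim_l V x u) = x ∘ beta u.
  by have [+ _] := inv x u; rewrite !scale1r.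
have br x u : beta (bim_r V x u) = beta u ∘ x.
  by have [_ +] := inv x u; rewrite !scale1r.
have [ax1 ax2 ax3 ax4] := bim_axiom V.
have ax1' a b v : bim_l V (a ∘ b) v - bim_l V a (bim_l V b v)
    = bim_l V (b ∘ a) v - bim_l V b (bim_l V a v).
  have := ax1 a b v; rewrite linearB /= add_lfunE opp_lfunE => e.
  rewrite -[bim_l V (a ∘ b) v](subrK (bim_l V (b ∘ a) v)) e.
  by rewrite addrAC addrC [X in _ + X]addrAC subrr add0r.
split; first split.
- move=> u v w; rewrite !mE !linearZ /= !bl !linearZ /= !scale_lfunE.
  by rewrite -!scalerDr ax1'.
- move=> u v w; rewrite !mE !linearZ /= !bl ?linearZ /= !scale_lfunE !ax3.
  by rewrite !bal ax4.
split.
- move=> a v w; rewrite !mE !bl !br linearZ /= -!scalerBr.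
  by rewrite ax1'.
- move=> a v w; rewrite !mE !linearZ /= -!scalerDr; congr (_ *: _).
  rewrite (bal w (bim_r V a v)) br (bal w v).
  by rewrite -[LHS]opprB ax2 opprB.
- by move=> a v w; rewrite !mE bal -ax3 bl.
- by move=> a v w; rewrite !mE !linearZ /= br ax3.
Qed.

Definition bimod_novikov_of (V : bimodule) (beta : 'Hom(V, A)) (c : k)
    (bal : balanced beta) (inv : inv_of_mass 1 beta) : bimodNovikov :=
  BimodNovikov (bimod_novikov_of_balanced c bal inv).

Lemma dual_is_bimodule : is_bimodule (dualrep Lstar) (- dualrep Rmul).
Proof.
have [lsym rcom] := nov_axiom A.
have lE a (f : dual A) v : dualrep Lstar a f v = - f (star a v).
  by rewrite dualrepE LstarE.
have rE a (f : dual A) v : (- dualrep Rmul) a f v = f (v ∘ a).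
  by rewrite !opp_lfunE dualrepE RmulE opprK.
have subE (f g : dual A) v : (f - g) v = f v - g v.
  by rewrite add_lfunE opp_lfunE.
have lsym' (a b c : A) : a ∘ (b ∘ c) = (a ∘ b) ∘ c - (b ∘ a) ∘ c + b ∘ (a ∘ c).
  exact: (zmod_move (lsym a b c)).
have mDl (a b c : A) : (a + b) ∘ c = a ∘ c + b ∘ c by rewrite linearD add_lfunE.
have mBl (a b c : A) : (a - b) ∘ c = a ∘ c - b ∘ c.
  by rewrite linearB /= add_lfunE opp_lfunE.
have mDr (a b c : A) : a ∘ (b + c) = a ∘ b + a ∘ c by rewrite linearD.
have mBr (a b c : A) : a ∘ (b - c) = a ∘ b - a ∘ c by rewrite linearB.
split=> a b f; apply/lfunP=> v.
- rewrite subE !lE !opprK /star !(mBl, mBr, mDl, mDr).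
  rewrite (lsym' a b v) (lsym' v a b) (lsym' v b a) !(linearB f, linearD f) /=.
  rewrite (rcom v b a); ring.
- rewrite !subE !(lE, rE) /star !(mBl, mBr, mDl, mDr).
  rewrite (rcom v b a) (lsym' v a b) !(linearB f, linearD f) /=.
  ring.
- rewrite rE !lE /star (rcom v b a) (rcom a b v) (lsym' v a b).
  rewrite !(linearB f, linearD f) /=; ring.
- by rewrite !rE rcom.
Qed.

Definition dual_bimodule : bimodule := Bimodule dual_is_bimodule.

End Bimodules.

Section NYBE.
Variables (k : fieldType) (A : novikovAlg k).
Implicit Types (r s : tensor A A) (x y : A) (a b : dual A).

Definition circ_13_23 r : tensor (tensor A A) A :=
  tlift (fun x y => tlift (fun x' y' => x ⊗ x' ⊗ (y ∘ y')) r) r.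

Definition star_12_23 r : tensor (tensor A A) A :=
  tlift (fun x y => tlift (fun x' y' => x ⊗ star y x' ⊗ y') r) r.

Definition circ_13_12 r : tensor (tensor A A) A :=
  tlift (fun x y => tlift (fun x' y' => (x ∘ x') ⊗ y' ⊗ y) r) r.

Definition nybe r : Prop := circ_13_23 r + star_12_23 r + circ_13_12 r = 0.

Let tensPl (U V : vectType k) (v : V) : linear (fun u : U => u ⊗ v).
Proof. by have [_ +] := tens_bilin U V; apply. Qed.

Let tensPr (U V : vectType k) (u : U) : linear (fun v : V => u ⊗ v).
Proof. by have [+ _] := tens_bilin U V; apply. Qed.

Let mulPl y : linear (fun x => x ∘ y).
Proof. by move=> c u v; rewrite linearP add_lfunE scale_lfunE. Qed.

Let mulPr x : linear (fun y => x ∘ y).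
Proof. by move=> c u v; rewrite linearP. Qed.

Let starPl y : linear (fun x => star x y).
Proof. by move=> c u v; rewrite /star mulPl mulPr scalerDr addrACA. Qed.

Let starPr x : linear (fun y => star x y).
Proof. by move=> c u v; rewrite /star mulPl mulPr scalerDr addrACA. Qed.

Lemma circ_13_23E (t : seq (A * A)) :
  circ_13_23 (\sum_(p <- t) p.1 ⊗ p.2)
  = \sum_(p <- t) \sum_(q <- t) p.1 ⊗ q.1 ⊗ (p.2 ∘ q.2).
Proof.
apply: (tlift2_sum (f := fun x y x' y' => x ⊗ x' ⊗ (y ∘ y'))) => x y.
  by split=> [u|v] c z w; rewrite ?mulPr ?tensPr ?tensPl.
by split=> [u|v] c z w; rewrite ?mulPl ?tensPr ?tensPl // tensPl.
Qed.

Lemma star_12_23E (t : seq (A * A)) :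
  star_12_23 (\sum_(p <- t) p.1 ⊗ p.2)
  = \sum_(p <- t) \sum_(q <- t) p.1 ⊗ star p.2 q.1 ⊗ q.2.
Proof.
apply: (tlift2_sum (f := fun x y x' y' => x ⊗ star y x' ⊗ y')) => x y.
  by split=> [u|v] c z w; rewrite ?starPr ?tensPr ?tensPl.
by split=> [u|v] c z w; rewrite ?starPl ?tensPr ?tensPl.
Qed.

Lemma circ_13_12E (t : seq (A * A)) :
  circ_13_12 (\sum_(p <- t) p.1 ⊗ p.2)
  = \sum_(p <- t) \sum_(q <- t) (p.1 ∘ q.1) ⊗ q.2 ⊗ p.2.
Proof.
apply: (tlift2_sum (f := fun x y x' y' => (x ∘ x') ⊗ y' ⊗ y)) => x y.
  by split=> [u|v] c z w; rewrite ?mulPr ?tensPr ?tensPl.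
by split=> [u|v] c z w; rewrite ?mulPl ?tensPr ?tensPl.
Qed.

(* Only used for symmetric s; see [beta_check_sym]. *)
Definition is_invariant s : Prop :=
  forall x, tmap (Lmul A x) \1%VF s + tmap \1%VF (Lstar A x) s = 0.

Definition alpha_of r : 'Hom(dual A, A) := 2%:R^-1 *: (hat r - hatt r).
Definition beta_of r : 'Hom(dual A, A) := 2%:R^-1 *: (hat r + hatt r).
Definition beta_check r : tensor A A := 2%:R^-1 *: (r + tswap r).

Definition ast r a b : dual A :=
  dualrep (Lstar A) (hat r a) b - dualrep (- Rmul A) (hatt r b) a.

Lemma beta_check_sym r : tswap (beta_check r) = beta_check r.
Proof.
have tl : linear (@tswap k A A) := tlift_linear _.
rewrite /beta_check (linear_scaleP tl); congr (_ *: _).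
have [t ->] := tensor_decomp r.
have := tl 1 (\sum_(p <- t) p.1 ⊗ p.2) (tswap (\sum_(p <- t) p.1 ⊗ p.2)).
rewrite !scale1r => ->; rewrite addrC tswapE; congr (_ + _).
have -> : \sum_(p <- t) p.2 ⊗ p.1
    = \sum_(q <- [seq (p.2, p.1) | p <- t]) q.1 ⊗ q.2 by rewrite big_map.
by rewrite tswapE big_map.
Qed.

Lemma tpairP a b : linear (tpair a b : tensor A A -> k^o).
Proof. exact: tlift_linear. Qed.

Lemma beta_pair r a b : b (beta_of r a) = tpair a b (beta_check r).
Proof.
rewrite /beta_of scale_lfunE add_lfunE linearZ linearD /=.
rewrite hatP hattP -[tpair b a r]tpair_swap.
rewrite /beta_check (linear_scaleP (tpairP a b)); congr (_ *: _).
by have := tpairP a b 1 r (tswap r); rewrite !scale1r.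
Qed.

Lemma beta_sym r a b : b (beta_of r a) = a (beta_of r b).
Proof.
rewrite /beta_of !scale_lfunE !add_lfunE !linearZ !linearD /=.
by rewrite !hatP !hattP addrC.
Qed.

Lemma beta_inv r : is_invariant (beta_check r) ->
  forall x a b, a (x ∘ beta_of r b) = - b (star x (beta_of r a)).
Proof.
move=> inv x a b; apply/eqP; rewrite -addr_eq0; apply/eqP.
have := tpairP a b 1 (tmap (Lmul A x) \1%VF (beta_check r))
  (tmap \1%VF (Lstar A x) (beta_check r)).
rewrite !scale1r inv !tpair_map -!beta_pair !comp_lfun1r.
have -> : tpair a b 0 = 0 by rewrite -[0](scale0r 0) (linear_scaleP (tpairP a b)) scale0r.
by move=> ->; rewrite beta_sym !comp_lfunE LstarE.
Qed.

Lemma dual_l x a y : bim_l (dual_bimodule A) x a y = - a (star x y).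
Proof. by rewrite dualrepE LstarE. Qed.

Lemma dual_r x a y : bim_r (dual_bimodule A) x a y = a (y ∘ x).
Proof. by rewrite !opp_lfunE dualrepE RmulE opprK. Qed.

Lemma beta_balanced r : is_invariant (beta_check r) ->
  balanced (V := dual_bimodule A) (beta_of r).
Proof.
move=> /beta_inv inv u v; apply/lfunP => x; rewrite dual_l dual_r inv.
by rewrite /star addrC.
Qed.

Lemma beta_inv_mass r : is_invariant (beta_check r) ->
  inv_of_mass (V := dual_bimodule A) 1 (beta_of r).
Proof.
move=> /beta_inv inv x u; rewrite !scale1r; split; apply: dual_inj => b.
  by rewrite inv [RHS]beta_sym dual_l.
rewrite [RHS]beta_sym dual_r.
have e (z w : A) : z ∘ w = star w z - w ∘ z by rewrite /star addrC addKr.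
by rewrite (e (beta_of r u)) (e (beta_of r b)) !linearB /= !inv !opprK addrC.
Qed.

(* The product is a, b |-> c *: L_star^* (beta a) b; the two products circ_+   *)
(* and circ_- are the cases c = -2 and c = 2.                                 *)
Definition dual_bimod_novikov (c : k) r (inv : is_invariant (beta_check r)) :
    bimodNovikov A :=
  bimod_novikov_of c (beta_balanced inv) (beta_inv_mass inv).

Lemma dual_bimod_novikovE c r (inv : is_invariant (beta_check r)) a b :
  bn_mul (dual_bimod_novikov c inv) a b
  = c *: dualrep (Lstar A) (beta_of r a) b.
Proof. by rewrite scale_lfunE scale_lfunE comp_lfunE. Qed.

End NYBE.

(* Main.v *)
(* Put u * v = l (alpha u) v + r (alpha v) u.  Since beta is balanced and       *)
(* invariant, beta (u * v) is the mixed part of the expansion of               *)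
(* (alpha +- beta) u ∘ (alpha +- beta) v; so either of the maps alpha +- beta  *)
(* is multiplicative iff alpha (u * v) = alpha u ∘ alpha v + beta u ∘ beta v,  *)
(* a condition that does not depend on the sign.  This gives (b), (c) and (d); *)
(* pairing the Yang-Baxter equation with a ⊗ b ⊗ c gives c applied to          *)
(* hat r a ∘ hat r b - hat r (a * b), hence (a).                               *)
Require Import Defs.
From mathcomp Require Import all_boot all_order all_algebra.

Set Implicit Arguments.
Unset Strict Implicit.
Unset Printing Implicit Defensive.

Import GRing.Theory.
Local Open Scope ring_scope.
Local Open Scope tensor_scope.

(** All the statements meet in [alpha_beta_eq]. By [inv_induced_prod] the cross terms of a product
    of values of alpha + e beta are e beta of the induced product, so for e * e = 1 multiplicativity
    does not see the sign e ([multiplicativeP]). The weight 1 products only absorb the beta part of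
    the bimodule action ([O_operatorP]). For the Yang-Baxter equation, [tpair3_nybe] reads the
    tensor through functionals as the failure of [hat r] to be multiplicative for [ast], and
    [ast_induced_prod] identifies [ast] with the induced product of alpha. *)

Section TensorSeparation.
Variable k : fieldType.

(** The functionals are members of the dual bases. *)
Lemma tpair_coord (U V : vectType k) (t : tensor U V) i j :
  exists (a : dual U) (b : dual V), tpair a b t = (t : 'M_(_, _)) i j.
Proof.
pose a : {linear U -> k^o} := coord (vbasis {:U}) i.
pose b : {linear V -> k^o} := coord (vbasis {:V}) j.
exists (linfun a), (linfun b).
have fU := basis_free (vbasisP {:U}); have fV := basis_free (vbasisP {:V}).
rewrite /tpair /tlift (bigD1 i) //= (bigD1 j) //= !lfunE /= !coord_free //.
rewrite !eqxx mulr1 [_ *: _]mulr1 big1 => [|j' neq]; last first.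
  by rewrite !lfunE /= !coord_free // (negbTE neq) mulr0 scaler0.
rewrite big1 ?addr0 // => i' neq; rewrite big1 // => j' _.
by rewrite !lfunE /= !coord_free // (negbTE neq) mul0r scaler0.
Qed.

Lemma tpair_eq0 (U V : vectType k) (t : tensor U V) :
  (forall a b, tpair a b t = 0) -> t = 0.
Proof.
move=> t0; apply/matrixP=> i j; rewrite [RHS]mxE.
by have [a [b <-]] := tpair_coord t i j.
Qed.

Definition tpair_fun (U V : vectType k) (a : dual U) (b : dual V) :
  dual (tensor U V) := linfun (tpair a b).

Lemma tpair_funE (U V : vectType k) (a : dual U) (b : dual V) t :
  tpair_fun a b t = tpair a b t.
Proof. by rewrite linfunP //; apply: tlift_linear. Qed.

Lemma tpair3_eq0 (U V W : vectType k) (t : tensor (tensor U V) W) :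
  (forall a b c, tpair (tpair_fun a b) c t = 0) -> t = 0.
Proof.
(* The functional [f] on the inner tensor product need not be pure; moving [c] to the other side
   through [hatt] leaves a vector of that product, which pure functionals detect. *)
move=> t0; apply: tpair_eq0 => f c; rewrite -hattP.
have -> : hatt t c = 0.
  by apply: tpair_eq0 => a b; rewrite -tpair_funE hattP t0.
by rewrite linear0.
Qed.

End TensorSeparation.

Section ExtendedOperators.
Variables (k : fieldType) (A : novikovAlg k) (V : bimodule A).
Implicit Types (alpha beta : 'Hom(V, A)) (u v : V).

Definition induced_prod alpha u v : V :=
  bim_l V (alpha u) v + bim_r V (alpha v) u.

Definition alpha_beta_eq alpha beta : Prop := forall u v,
  alpha (induced_prod alpha u v) = alpha u ∘ alpha v + beta u ∘ beta v.

Lemma nov_mulDl (x y z : A) : (x + y) ∘ z = x ∘ z + y ∘ z.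
Proof. by rewrite linearD add_lfunE. Qed.

Lemma nov_mulDr (x y z : A) : x ∘ (y + z) = x ∘ y + x ∘ z.
Proof. by rewrite linearD. Qed.

Lemma nov_mulZl c (x y : A) : (c *: x) ∘ y = c *: (x ∘ y).
Proof. by rewrite linearZ scale_lfunE. Qed.

Lemma nov_mulZr c (x y : A) : x ∘ (c *: y) = c *: (x ∘ y).
Proof. by rewrite linearZ. Qed.

Variables (alpha beta : 'Hom(V, A)).
Hypotheses (bal : balanced beta) (inv : inv_of_mass 1 beta).

(** Invariance at [alpha u] handles the left action, invariance at [alpha v] the right one. *)
Lemma inv_induced_prod u v :
  beta (induced_prod alpha u v) = alpha u ∘ beta v + beta u ∘ alpha v.
Proof.
have [+ _] := inv (alpha u) v; have [_ +] := inv (alpha v) u.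
by rewrite !scale1r linearD /= => <- <-.
Qed.

(** With opposite signs the two beta contributions cancel by balance. This is the shape of [ast],
    built from [hat r] and [- hatt r]. *)
Lemma induced_prod_balanced u v :
  bim_l V ((alpha + beta) u) v + bim_r V ((alpha - beta) v) u
  = induced_prod alpha u v.
Proof.
rewrite !add_lfunE !opp_lfunE linearD linearB /= !add_lfunE opp_lfunE -bal.
by rewrite addrACA subrr addr0.
Qed.

Lemma multiplicativeP (e : k) : e * e = 1 ->
  (forall u v, (alpha + e *: beta) (induced_prod alpha u v)
     = (alpha + e *: beta) u ∘ (alpha + e *: beta) v)
  <-> alpha_beta_eq alpha beta.
Proof.
move=> ee.
have E u v : (alpha + e *: beta) u ∘ (alpha + e *: beta) v
    = alpha u ∘ alpha v + beta u ∘ beta v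
      + (e *: beta) (induced_prod alpha u v).
  rewrite !add_lfunE !scale_lfunE inv_induced_prod !(nov_mulDl, nov_mulDr).
  rewrite !(nov_mulZl, nov_mulZr) scalerA ee scale1r scalerDr.
  by rewrite -!addrA; congr (_ + _); rewrite addrA addrC.
split=> h u v; last by rewrite E add_lfunE h.
by apply: (addIr ((e *: beta) (induced_prod alpha u v))); rewrite -E -h add_lfunE.
Qed.

(** With equal signs balance doubles the beta contribution to 2 e l(beta u) v; the product with c =
    - 2 e removes exactly this. *)
Lemma O_operatorP (c e : k) : c = - 2%:R * e -> e * e = 1 ->
  O_operator (M := bimod_novikov_of c bal inv) 1 (alpha + e *: beta)
  <-> alpha_beta_eq alpha beta.
Proof.
move=> -> ee; rewrite -(multiplicativeP ee).
have E u v : bim_l V ((alpha + e *: beta) u) v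
    + bim_r V ((alpha + e *: beta) v) u
    + 1 *: bn_mul (bimod_novikov_of (- 2%:R * e) bal inv) u v
    = induced_prod alpha u v.
  rewrite scale1r !scale_lfunE comp_lfunE !add_lfunE !scale_lfunE.
  rewrite !linearD !linearZ !add_lfunE !scale_lfunE /= -bal addrACA -addrA.
  by rewrite -!scalerDl mulNr mulr_natl mulr2n scaleNr !addrA addrK.
by split=> h u v; rewrite -?E ?h ?E // (h u v) E.
Qed.

Lemma extended_O_operatorP :
  extended_O_operator (- 1) alpha beta <-> alpha_beta_eq alpha beta.
Proof.
split=> [[_ _ h] u v|h].
  have := h u v; rewrite scaleN1r => /eqP; rewrite subr_eq addrC eq_sym.
  by rewrite subr_eq => /eqP.
split=> // [x u|u v]; last by rewrite h opprD addrA subrr sub0r scaleN1r.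
(* Invariance of mass 1 gives invariance of any mass by scaling. *)
by have [+ +] := inv x u; rewrite !scale1r => <- <-.
Qed.

End ExtendedOperators.

Section YangBaxter.
Variables (k : fieldType) (A : novikovAlg k) (r : tensor A A).
Implicit Types a b c : dual A.

Lemma tpair_sum (U V : vectType k) (I : Type) (s : seq I)
    (F : I -> tensor U V) (a : dual U) (b : dual V) :
  tpair a b (\sum_(i <- s) F i) = \sum_(i <- s) tpair a b (F i).
Proof. exact: (linear_sumP (tlift_linear _)). Qed.

Lemma tpair_tens (U V : vectType k) (a : dual U) (b : dual V) u v :
  tpair a b (u ⊗ v) = a u * b v.
Proof. exact: (tlift_tens _ _ (tpair_bilin a b)). Qed.

Lemma bilinear_sum (U V W : vectType k) (m : 'Hom(U, 'Hom(V, W)))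
    (I : Type) (s : seq I) (x : I -> k) (u : I -> U) (y : I -> k) (v : I -> V) :
  m (\sum_(p <- s) x p *: u p) (\sum_(q <- s) y q *: v q)
  = \sum_(p <- s) \sum_(q <- s) (x p * y q) *: m (u p) (v q).
Proof.
rewrite (linear_sum m) sum_lfunE; apply: eq_bigr => p _.
rewrite (linear_sum (m _)); apply: eq_bigr => q _.
by rewrite linearZ linearZ /= scale_lfunE scalerA mulrC.
Qed.

Lemma tpair3_circ_13_23 a b c :
  tpair (tpair_fun a b) c (circ_13_23 r) = c (hat r a ∘ hat r b).
Proof.
have [s ->] := tensor_decomp r; rewrite circ_13_23E !hatE bilinear_sum.
rewrite linear_sum tpair_sum; apply: eq_bigr => p _ /=.
rewrite linear_sum tpair_sum; apply: eq_bigr => q _ /=.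
by rewrite tpair_tens tpair_funE tpair_tens linearZ.
Qed.

Lemma tpair3_star_12_23 a b c :
  tpair (tpair_fun a b) c (star_12_23 r) = b (star (hat r a) (hatt r c)).
Proof.
have [s ->] := tensor_decomp r.
rewrite star_12_23E hatE hattE -LstarE bilinear_sum.
rewrite linear_sum tpair_sum; apply: eq_bigr => p _ /=.
rewrite linear_sum tpair_sum; apply: eq_bigr => q _ /=.
by rewrite tpair_tens tpair_funE tpair_tens linearZ LstarE mulrAC.
Qed.

Lemma tpair3_circ_13_12 a b c :
  tpair (tpair_fun a b) c (circ_13_12 r) = a (hatt r c ∘ hatt r b).
Proof.
have [s ->] := tensor_decomp r; rewrite circ_13_12E !hattE bilinear_sum.
rewrite linear_sum tpair_sum; apply: eq_bigr => p _ /=.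
rewrite linear_sum tpair_sum; apply: eq_bigr => q _ /=.
by rewrite tpair_tens tpair_funE tpair_tens linearZ mulrC (mulrC (a _)) mulrA.
Qed.

Lemma hat_hatt a b : a (hatt r b) = b (hat r a).
Proof. by rewrite hatP hattP. Qed.

(** The last two terms are, up to sign, the two halves of [ast r a b] evaluated at [hatt r c];
    [hat_hatt] turns this value into [c] of [hat r (ast r a b)]. *)
Lemma tpair3_nybe a b c :
  tpair (tpair_fun a b) c (circ_13_23 r + star_12_23 r + circ_13_12 r)
  = c (hat r a ∘ hat r b - hat r (ast r a b)).
Proof.
have tD x y : tpair (tpair_fun a b) c (x + y)
    = tpair (tpair_fun a b) c x + tpair (tpair_fun a b) c y.
  by rewrite -!tpair_funE linearD.
rewrite !tD tpair3_circ_13_23 tpair3_star_12_23 tpair3_circ_13_12.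
rewrite linearB /= -[c (hat r (ast r a b))]hat_hatt /ast.
rewrite add_lfunE opp_lfunE !dualrepE LstarE !opp_lfunE RmulE.
by rewrite opprD !opprK addrA linearN opprK.
Qed.

Lemma nybeP :
  nybe r <-> forall a b, hat r (ast r a b) = hat r a ∘ hat r b.
Proof.
split=> [h a b|h].
  apply/esym/eqP; rewrite -subr_eq0; apply/eqP/dual_inj => c.
  by rewrite -tpair3_nybe h -tpair_funE !linear0.
by apply: tpair3_eq0 => a b c; rewrite tpair3_nybe h subrr linear0.
Qed.

Hypothesis two_neq0 : 2%:R != 0 :> k.

Lemma hat_alpha_beta : hat r = alpha_of r + beta_of r.
Proof.
rewrite /alpha_of /beta_of -scalerDr addrACA [- _ + _]addrC subrr addr0.
by rewrite -mulr2n -scaler_nat scalerA mulVf // scale1r.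
Qed.

Lemma hatt_alpha_beta : - hatt r = alpha_of r - beta_of r.
Proof.
rewrite /alpha_of /beta_of -scalerBr opprD addrACA subrr add0r.
by rewrite -opprD -mulr2n -scaler_nat scalerN scalerA mulVf // scale1r.
Qed.

Lemma ast_induced_prod (inv : is_invariant (beta_check r)) a b :
  ast r a b = induced_prod (V := dual_bimodule A) (alpha_of r) a b.
Proof.
rewrite -(induced_prod_balanced _ (beta_balanced inv)).
rewrite -hat_alpha_beta -hatt_alpha_beta.
have -> // : ast r a b = bim_l (dual_bimodule A) (hat r a) b
    + bim_r (dual_bimodule A) ((- hatt r) b) a.
  congr (_ + _); apply/lfunP => x; rewrite [RHS]dual_r.
  rewrite !opp_lfunE dualrepE opprK; congr (a _).
  by rewrite !opp_lfunE RmulE linearN.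
Qed.

End YangBaxter.

Theorem corollary3p8 (k : fieldType) (char0 : [pchar k] =i pred0)
    (A : novikovAlg k) (r : tensor A A)
    (inv : is_invariant (beta_check r)) :
  let alpha := alpha_of r in
  let beta := beta_of r in
  [<-> nybe r;
       O_operator (M := dual_bimod_novikov (- 2%:R) inv) 1 (hat r);
       O_operator (M := dual_bimod_novikov 2%:R inv) 1 (- hatt r);
       extended_O_operator (V := dual_bimodule A) (- 1) alpha beta;
       forall a b : dual A,
         (alpha + beta) (ast r a b) = (alpha + beta) a ∘ (alpha + beta) b /\
         (alpha - beta) (ast r a b) = (alpha - beta) a ∘ (alpha - beta) b].
Proof.
have two : 2%:R != 0 :> k by rewrite (pcharf0P _).1.
move=> alpha beta; pose V := dual_bimodule A.
have bal : balanced (V := V) beta := beta_balanced inv.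
have im : inv_of_mass (V := V) 1 beta := beta_inv_mass inv.
(* [C] is the hub: each clause is compared with it, using e = 1 for [hat r] and e = -1 for
   [- hatt r]. *)
pose C := alpha_beta_eq (V := V) alpha beta.
have mulP : (forall a b, (alpha + beta) (ast r a b)
    = (alpha + beta) a ∘ (alpha + beta) b) <-> C.
  rewrite /C -(multiplicativeP (V := V) alpha im (e := 1)) ?mulr1 // scale1r.
  by split=> h a b; move: (h a b); rewrite (ast_induced_prod two inv).
have mulN : (forall a b, (alpha - beta) (ast r a b)
    = (alpha - beta) a ∘ (alpha - beta) b) <-> C.
  rewrite /C -(multiplicativeP (V := V) alpha im (e := -1)) ?mulrNN ?mulr1 // scaleN1r.
  by split=> h a b; move: (h a b); rewrite (ast_induced_prod two inv).
have aP : nybe r <-> C by rewrite nybeP -mulP (hat_alpha_beta _ two).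
have b1P : O_operator (M := dual_bimod_novikov (- 2%:R) inv) 1 (hat r) <-> C.
  rewrite (hat_alpha_beta _ two) -[beta_of r]scale1r.
  by apply: O_operatorP; rewrite ?mulr1.
have b2P : O_operator (M := dual_bimod_novikov 2%:R inv) 1 (- hatt r) <-> C.
  rewrite (hatt_alpha_beta _ two) -[- beta_of r]scaleN1r.
  by apply: O_operatorP; rewrite ?mulrNN ?mulr1.
have cP := extended_O_operatorP (V := V) alpha bal im.
tfae.
- by move/aP/b1P.
- by move/b1P/b2P.
- by move/b2P/cP.
- by move/cP=> h a b; split; [apply: (mulP.2 h) | apply: (mulN.2 h)].
- by move=> h; apply/aP/mulP => a b; have [] := h a b.
Qed.
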